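(* Let $S$ be a domain which is essentially of finite type over a field $k$, let $Q$ be an ideal of $S$, and let $R = k+Q\subset S$. If $Q = (f,g)S \subsetneq S$ for some nonzero elements $f,g$ of $S$, then $f,g$ is a strong parameter sequence in $R$ if and only if $H^2_{f,g}(S)\neq 0$. Furthermore, if $R$ is Cohen-Macaulay in the sense of Hamilton-Marley, then $H^2_{f,g}(S) = 0$.
   Context: All rings are commutative with unity. ''Essentially of finite type over $k$'' means a localization of a finitely generated $k$-algebra. $R=k+Q$ is the $k$-subalgebra $\{a+q : a\in k, q\in Q\}$ of $S$. Let $A$ be a ring and $\underline{x} = x_1,\dots,x_\ell$ a sequence of elements of $A$; write $\underline{x}^n = x_1^n,\dots,x_\ell^n$. Koszul complexes: $\mathbb{K}_\bullet(\underline{x})$ denotes the Koszul complex of $\underline{x}$ over $A$. For $n\ge m$ let $\varphi^n_m:\mathbb{K}_\bullet(\underline{x}^n)\to\mathbb{K}_\bullet(\underline{x}^m)$ be the natural chain map induced by multiplication by $(x_1x_2\cdots x_\ell)^{n-m}$ on $A$ (in top degree $\ell$); that is, the tensor product over $i=1,\dots,\ell$ of the chain maps $\mathbb{K}_\bullet(x_i^n)\to \mathbb{K}_\bullet(x_i^m)$ that are the identity in degree $0$ and multiplication by $x_i^{n-m}$ in degree $1$. Weakly proregular: $\underline{x}$ is weakly proregular if for each $m>0$ there is $n\ge m$ such that $H_i(\varphi^n_m): H_i(\mathbb{K}_\bullet(\underline{x}^n))\to H_i(\mathbb{K}_\bullet(\underline{x}^m))$ is zero for all $i\ge 1$. Čech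 cohomology: for an $A$-module $M$, $H^i_{\underline{x}}(M)$ is the $i$-th cohomology of the Čech complex $0\to M\to\bigoplus_i M_{x_i}\to\bigoplus_{i<j}M_{x_ix_j}\to\cdots\to M_{x_1\cdots x_\ell}\to 0$ (with $M$ in degree $0$). Parameter sequence: $\underline{x}$ is a parameter sequence on $A$ if (1) $(\underline{x})A\ne A$; (2) $\underline{x}$ is weakly proregular; (3) $H^\ell_{\underline{x}}(A)_{\mathfrak p}\neq 0$ for every prime ideal $\mathfrak p$ of $A$ containing $(\underline{x})A$. It is a strong parameter sequence on (or in) $A$ if $x_1,\dots,x_i$ is a parameter sequence on $A$ for all $1\le i\le \ell$. Cohen-Macaulay (Hamilton-Marley): a ring $A$ is Cohen-Macaulay if every strong parameter sequence on $A$ is a regular sequence on $A$.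
   Formalization: In the ''Furthermore'' part the inclusion R = k+Q ⊂ S is taken to be strict (R ≠ S); without this it fails, e.g. S = k[x,y], f = x, g = y, where R = S is Cohen-Macaulay but H^2_{x,y}(S) ≠ 0. *)

(* Defs.v *)
(* MathComp, with the classical axioms of mathcomp.classical.boolp. *)
From HB Require Import structures.
From mathcomp Require Import all_boot all_order all_algebra.
From mathcomp Require Import boolp classical_sets.
From mathcomp Require Import ring.

Set Implicit Arguments.
Unset Strict Implicit.
Unset Printing Implicit Defensive.

Import GRing.Theory.

Local Open Scope classical_set_scope.
Local Open Scope ring_scope.
Local Open Scope quotient_scope.

(* Submodules of the regular module; contrary to [idealr], possibly improper. *)
Notation ideal A := (submodClosed A^o).

Definition ideal_gen (A : comNzRingType) (s : seq A) : set A :=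
  [set a | exists c : 'I_(size s) -> A, a = \sum_i c i * s`_i].

Lemma ideal_gen_mem (A : comNzRingType) (s : seq A) (a : A) :
  a \in s -> ideal_gen s a.
Proof.
move=> /(nthP 0)[i ltis <-]; exists (fun j => (j == Ordinal ltis)%:R).
rewrite (bigD1 (Ordinal ltis)) //= eqxx mul1r big1 ?addr0 // => j /negPf ->.
by rewrite mul0r.
Qed.

Definition is_zero_module (A : pzRingType) (M : lmodType A) : Prop :=
  forall u : M, u = 0.

Section QuotientModule.

Variables (A : nzRingType) (V : lmodType A) (N : submodClosed V).

(* [submodClosed] does not inherit from [zmodClosed]. *)
Definition submod_pred : {pred V} := fun v => v \in N.

Lemma submod_zmod_closed : zmod_closed submod_pred.
Proof. exact: (submodClosedP N). Qed.
HB.instance Definition _ := GRing.isZmodClosed.Build V submod_pred submod_zmod_closed.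

Definition quot_module := Quotient.quot submod_pred.

HB.instance Definition _ := GRing.Zmodule.on quot_module.

Definition quot_class (v : V) : quot_module := \pi_(Quotient.quot submod_pred) v.

Definition quot_scale (a : A) (u : quot_module) : quot_module :=
  quot_class (a *: repr (u : Quotient.quot submod_pred)).

Lemma quot_classE u v : (quot_class u = quot_class v) <-> (u - v \in N).
Proof.
have -> : (u - v \in N) = (u - v \in submod_pred) by [].
by rewrite Quotient.idealrBE; split=> [|/eqP]; [move/eqP|].
Qed.

Lemma quot_classK u : quot_class (repr (u : Quotient.quot submod_pred)) = u.
Proof. exact: reprK. Qed.

Lemma quot_classD : {morph quot_class : u v / u + v}.
Proof. exact: (raddfD (\pi_(Quotient.quot submod_pred))). Qed.

Lemma quot_scaleE a v : quot_scale a (quot_class v) = quot_class (a *: v).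
Proof.
apply/quot_classE; rewrite -scalerBr rpredZ //; apply/quot_classE.
exact: quot_classK.
Qed.

Lemma quot_scaleA a b v : quot_scale a (quot_scale b v) = quot_scale (a * b) v.
Proof. by rewrite -[v]quot_classK !quot_scaleE scalerA. Qed.
Lemma quot_scale1 : left_id 1 quot_scale.
Proof. by move=> v; rewrite -[v]quot_classK quot_scaleE scale1r. Qed.
Lemma quot_scaleDr : right_distributive quot_scale +%R.
Proof.
move=> a u v; rewrite -[u]quot_classK -[v]quot_classK -quot_classD.
by rewrite !quot_scaleE scalerDr quot_classD.
Qed.
Lemma quot_scaleDl v : {morph quot_scale^~ v : a b / a + b}.
Proof.
move=> a b; rewrite -[v]quot_classK.
by rewrite !quot_scaleE scalerDl quot_classD.
Qed.

HB.instance Definition _ := GRing.Zmodule_isLmodule.Build A quot_module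
  quot_scaleA quot_scale1 quot_scaleDr quot_scaleDl.

Lemma quot_class_is_linear : linear quot_class.
Proof.
by move=> a u v; rewrite quot_classD -quot_scaleE.
Qed.
HB.instance Definition _ :=
  GRing.isLinear.Build A V quot_module _ quot_class quot_class_is_linear.

End QuotientModule.

Section Homology.

Variables (A : nzRingType) (U V W : lmodType A).
Variables (f : {linear U -> V}) (g : {linear V -> W}).

Definition ker_pred : {pred V} := fun v => g v == 0.

Lemma ker_submod_closed : subsemimod_closed ker_pred.
Proof.
split; first split; rewrite /in_mem /= /ker_pred ?linear0 //.
  by move=> u v; rewrite !unfold_in /ker_pred linearD => /eqP-> /eqP->; rewrite addr0.
by move=> a v; rewrite !unfold_in /ker_pred linearZ_LR => /eqP ->; rewrite /= scaler0.
Qed.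
HB.instance Definition _ := GRing.isSubmodClosed.Build A V ker_pred ker_submod_closed.

Record cycles := Cycle { cycle_val :> V; _ : cycle_val \in ker_pred }.

HB.instance Definition _ := [isSub for cycle_val].
HB.instance Definition _ := [Choice of cycles by <:].
HB.instance Definition _ := [SubChoice_isSubLmodule of cycles by <:].

Definition boundary_pred : {pred cycles} :=
  fun z => `[< exists u, f u = \val z >].

Lemma boundary_submod_closed : subsemimod_closed boundary_pred.
Proof.
split; first split.
- by apply/asboolP; exists 0; rewrite !linear0.
- move=> u v /asboolP[u' eu] /asboolP[v' ev]; apply/asboolP.
  by exists (u' + v'); rewrite !linearD /= eu ev.
- move=> a v /asboolP[v' ev]; apply/asboolP.
  by exists (a *: v'); rewrite !linearZ /= ev.
Qed.
HB.instance Definition _ :=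
  GRing.isSubmodClosed.Build A cycles boundary_pred boundary_submod_closed.

(* ker g / (im f :&: ker g); im f is contained in ker g in all uses. *)
Definition homology : lmodType A := quot_module boundary_pred.

Definition hclass : {linear cycles -> homology} := @quot_class A cycles boundary_pred.

Lemma hclassK (h : homology) : exists z, h = hclass z.
Proof. by exists (repr (h : Quotient.quot (submod_pred boundary_pred))); rewrite /hclass /= quot_classK. Qed.

Lemma hclass_eq0 z : hclass z = 0 <-> exists u, f u = \val z.
Proof.
rewrite -(linear0 hclass); split.
  by move/quot_classE; rewrite subr0 => /asboolP.
by move=> h; apply/quot_classE; rewrite subr0; apply/asboolP.
Qed.

End Homology.

Arguments boundary_pred {A U V W} f g.
Arguments hclass {A U V W} f g.
Arguments homology {A U V W} f g.

Section Localization.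

Variables (A : comNzRingType) (W : mulrClosed A) (M : lmodType A).

Definition fracpair : Type := (M * {w : A | w \in W})%type.
HB.instance Definition _ := Choice.on fracpair.

Definition fracpair_eq : rel fracpair := fun u v =>
  `[< exists2 t, t \in W & t *: (\val v.2 *: u.1) = t *: (\val u.2 *: v.1) >].

Lemma fracpair_equiv : equiv_class_of fracpair_eq.
Proof.
split=> [u|u v|v u w].
- by apply/asboolP; exists 1; rewrite ?rpred1.
- by apply/asboolP/asboolP=> -[t Wt e]; exists t.
move=> /asboolP[s Ws es] /asboolP[t Wt et]; apply/asboolP.
exists (s * t * \val v.2); first by rewrite !rpredM // (valP v.2).
transitivity ((t * \val w.2) *: (s *: (\val v.2 *: u.1))).
  by rewrite !scalerA; congr (_ *: _); ring.
rewrite es; transitivity ((s * \val u.2) *: (t *: (\val w.2 *: v.1))).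
  by rewrite !scalerA; congr (_ *: _); ring.
by rewrite et !scalerA; congr (_ *: _); ring.
Qed.

Canonical fracpair_equiv_rel := EquivRelPack fracpair_equiv.
Canonical fracpair_encModRel := defaultEncModRel fracpair_eq.

(* W^-1 M *)
Definition loc := {eq_quot fracpair_eq}.
HB.instance Definition _ := Choice.on loc.

(* m / w *)
Definition frac (m : M) (w : A) (Ww : w \in W) : loc :=
  \pi_({eq_quot fracpair_eq}) (m, exist _ w Ww).

Lemma frac_eq m w (Ww : w \in W) m' w' (Ww' : w' \in W) :
  frac m Ww = frac m' Ww' <->
  exists2 t, t \in W & t *: (w' *: m) = t *: (w *: m').
Proof.
split; first by move/eqquotP/asboolP.
by move=> h; apply/eqquotP/asboolP.
Qed.

Lemma fracP (u : loc) : exists m w (Ww : w \in W), u = frac m Ww.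
Proof.
case E: (repr u) => [m [w Ww]]; exists m, w, Ww.
by rewrite -[LHS]reprK E.
Qed.

(* A function on fractions induced by [F], meant for an [F] which is
   independent of the representation of the fraction (see [frac_liftE]). *)
Definition frac_lift (T : Type) (F : forall m w, w \in W -> T) (u : loc) : T :=
  F (repr u).1 (\val (repr u).2) (valP (repr u).2).

Lemma frac_liftE T (F : forall m w, w \in W -> T) :
    (forall m w (Ww : w \in W) m' w' (Ww' : w' \in W),
       frac m Ww = frac m' Ww' -> F m w Ww = F m' w' Ww') ->
  forall m w (Ww : w \in W), frac_lift F (frac m Ww) = F m w Ww.
Proof.
move=> FP m w Ww; rewrite /frac_lift.
have := reprK (frac m Ww); case: (repr _) => m' [w' Ww'] e /=.
by apply: FP; rewrite -[RHS]e; congr (\pi_(_) (_, exist _ _ _)).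
Qed.

Definition loc_add (u v : loc) : loc :=
  frac_lift (fun m w Ww => frac_lift (fun m' w' Ww' =>
    frac (w' *: m + w *: m') (rpredM Ww Ww')) v) u.
Definition loc_opp : loc -> loc := frac_lift (fun m w Ww => frac (- m) Ww).
Definition loc_zero : loc := frac 0 (rpred1 W).
Definition loc_scale (a : A) : loc -> loc :=
  frac_lift (fun m w Ww => frac (a *: m) Ww).

Lemma loc_addE m w (Ww : w \in W) m' w' (Ww' : w' \in W) :
  loc_add (frac m Ww) (frac m' Ww') =
  frac (w' *: m + w *: m') (rpredM Ww Ww').
Proof.
rewrite /loc_add frac_liftE; last first.
  move=> {}m {}w {}Ww n x Wx /frac_eq[t Wt e]; congr frac_lift.
  apply: functional_extensionality_dep => p; apply: functional_extensionality_dep => y.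
  apply: functional_extensionality_dep => Wy; apply/frac_eq; exists t => //.
  rewrite !scalerDr !scalerA; congr (_ + _); last by congr (_ *: _); ring.
  transitivity ((y * y) *: (t *: (x *: m))); first by rewrite !scalerA; congr (_ *: _); ring.
  by rewrite e !scalerA; congr (_ *: _); ring.
rewrite frac_liftE // => n x Wx n' x' Wx' /frac_eq[t Wt e]; apply/frac_eq; exists t => //.
rewrite !scalerDr !scalerA; congr (_ + _); first by congr (_ *: _); ring.
transitivity ((w * w) *: (t *: (x' *: n))); first by rewrite !scalerA; congr (_ *: _); ring.
by rewrite e !scalerA; congr (_ *: _); ring.
Qed.

Lemma loc_oppE m w (Ww : w \in W) : loc_opp (frac m Ww) = frac (- m) Ww.
Proof.
rewrite /loc_opp frac_liftE // => {}m {}w {}Ww m' w' Ww' /frac_eq[t Wt e].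
by apply/frac_eq; exists t => //; rewrite !scalerN e.
Qed.

Lemma loc_scaleE a m w (Ww : w \in W) : loc_scale a (frac m Ww) = frac (a *: m) Ww.
Proof.
rewrite /loc_scale frac_liftE // => {}m {}w {}Ww m' w' Ww' /frac_eq[t Wt e].
apply/frac_eq; exists t => //.
transitivity (a *: (t *: (w' *: m))); first by rewrite !scalerA; congr (_ *: _); ring.
by rewrite e !scalerA; congr (_ *: _); ring.
Qed.

Let frac_eq1 m w (Ww : w \in W) m' w' (Ww' : w' \in W) :
  w' *: m = w *: m' -> frac m Ww = frac m' Ww'.
Proof. by move=> e; apply/frac_eq; exists 1; rewrite ?rpred1 ?e. Qed.

Let fracPE (P : loc -> Prop) :
  (forall m w (Ww : w \in W), P (frac m Ww)) -> forall u, P u.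
Proof. by move=> h u; have [m [w [Ww ->]]] := fracP u. Qed.

Lemma loc_addA : associative loc_add.
Proof.
elim/fracPE=> m w Ww; elim/fracPE=> n x Wx; elim/fracPE=> p y Wy.
rewrite !loc_addE; apply: frac_eq1; rewrite !scalerDr !scalerA addrA.
by congr (_ + _ + _); congr (_ *: _); ring.
Qed.
Lemma loc_addC : commutative loc_add.
Proof.
elim/fracPE=> m w Ww; elim/fracPE=> n x Wx.
by rewrite !loc_addE; apply: frac_eq1; rewrite addrC (mulrC w).
Qed.
Lemma loc_add0 : left_id loc_zero loc_add.
Proof.
by elim/fracPE=> m w Ww; rewrite loc_addE; apply: frac_eq1; rewrite scaler0 add0r scale1r mul1r.
Qed.
Lemma loc_addN : left_inverse loc_zero loc_opp loc_add.
Proof.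
elim/fracPE=> m w Ww; rewrite loc_oppE loc_addE; apply: frac_eq1.
by rewrite scalerN addNr !scaler0.
Qed.
HB.instance Definition _ :=
  GRing.isZmodule.Build loc loc_addA loc_addC loc_add0 loc_addN.

Lemma loc_scaleA a b u : loc_scale a (loc_scale b u) = loc_scale (a * b) u.
Proof. by elim/fracPE: u => m w Ww; rewrite !loc_scaleE scalerA. Qed.
Lemma loc_scale1 : left_id 1 loc_scale.
Proof. by elim/fracPE=> m w Ww; rewrite loc_scaleE scale1r. Qed.
Lemma loc_scaleDr : right_distributive loc_scale +%R.
Proof.
move=> a; elim/fracPE=> m w Ww; elim/fracPE=> n x Wx.
rewrite [_ + _]loc_addE !loc_scaleE [RHS]loc_addE; apply: frac_eq1.
rewrite !scalerDr !scalerA.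
by congr (_ + _); congr (_ *: _); ring.
Qed.
Lemma loc_scaleDl u : {morph loc_scale^~ u : a b / a + b}.
Proof.
elim/fracPE: u => m w Ww a b; rewrite !loc_scaleE [RHS]loc_addE; apply: frac_eq1.
by rewrite -!scalerDr -scalerDl !scalerA; congr (_ *: _); ring.
Qed.
HB.instance Definition _ := GRing.Zmodule_isLmodule.Build A loc
  loc_scaleA loc_scale1 loc_scaleDr loc_scaleDl.

Lemma fracD m w (Ww : w \in W) m' w' (Ww' : w' \in W) :
  frac m Ww + frac m' Ww' = frac (w' *: m + w *: m') (rpredM Ww Ww').
Proof. exact: loc_addE. Qed.

Lemma fracZ a m w (Ww : w \in W) : a *: frac m Ww = frac (a *: m) Ww.
Proof. exact: loc_scaleE. Qed.

Lemma frac0 : 0 = frac 0 (rpred1 W). Proof. by []. Qed.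

End Localization.

Section LocalizationMap.

Variables (A : comNzRingType) (M : lmodType A) (W1 W2 : mulrClosed A).

(* The canonical map W1^-1 M -> W2^-1 M, m / w |-> (t m) / (t w) for any t
   with t w in W2; it is meaningful when every element of W1 divides an element
   of W2, e.g. for M_x -> M_(y x), where m / x^n |-> (y^n m) / (y x)^n. *)
Definition loc_map : loc W1 M -> loc W2 M :=
  frac_lift (fun m w _ =>
    xget 0 [set v | exists t (Wtw : t * w \in W2), v = frac (t *: m) Wtw]).

Hypothesis W12 : forall w, w \in W1 -> exists t, t * w \in W2.

Lemma loc_mapE m w (Ww : w \in W1) t (Wtw : t * w \in W2) :
  loc_map (frac m Ww) = frac (t *: m) Wtw.
Proof.
have key (n : M) x (Wx : x \in W1) y (Wyx : y * x \in W2) (n' : M) x' (Wx' : x' \in W1) y'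
    (Wyx' : y' * x' \in W2) : frac n Wx = frac n' Wx' ->
    frac (y *: n) Wyx = frac (y' *: n') Wyx'.
  move=> /frac_eq[s Ws e]; have [r Wr] := W12 Ws; apply/frac_eq; exists (r * s) => //.
  transitivity ((r * y * y') *: (s *: (x' *: n))).
    by rewrite !scalerA; congr (_ *: _); ring.
  by rewrite e !scalerA; congr (_ *: _); ring.
have xgetE (n : M) x (Wx : x \in W1) y (Wyx : y * x \in W2) :
  xget 0 [set v | exists t (Wtw : t * x \in W2), v = frac (t *: n) Wtw]
    = frac (y *: n) Wyx.
  apply: xget_unique; first by exists y, Wyx.
  by move=> v [y' [Wyx' ->]]; exact: (key n x Wx y' Wyx' n x Wx).
rewrite /loc_map frac_liftE ?(xgetE _ _ Ww _ Wtw) //.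
move=> {t m w Ww Wtw} m w Ww m' w' Ww' e.
have [t Wt] := W12 Ww; have [t' Wt'] := W12 Ww'.
by rewrite (xgetE _ _ Ww _ Wt) (xgetE _ _ Ww' _ Wt'); exact: (key m w Ww t Wt m' w' Ww').
Qed.

Lemma loc_map_is_linear : linear loc_map.
Proof.
move=> a u v; have [m [w [Ww ->]]] := fracP u; have [n [x [Wx ->]]] := fracP v.
have [t Wt] := W12 Ww; have [s Ws] := W12 Wx.
have Wst : s * t * (w * x) \in W2.
  have -> : s * t * (w * x) = (t * w) * (s * x) by ring.
  exact: rpredM.
rewrite (loc_mapE _ _ Wt) (loc_mapE _ _ Ws) !fracZ !fracD (loc_mapE _ _ Wst).
apply/frac_eq; exists 1; rewrite ?rpred1 // !scale1r !scalerDr !scalerA.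
by congr (_ + _); congr (_ *: _); ring.
Qed.

End LocalizationMap.

Section LocalizationRing.

Variables (A : comNzRingType) (W : mulrClosed A).

(* W^-1 A as a ring; it is the zero ring when 0 \in W. *)
Definition loc_ring := loc W A^o.
HB.instance Definition _ := GRing.Lmodule.on loc_ring.

Definition loc_one : loc_ring := frac (1 : A^o) (rpred1 W).
Definition loc_mul (u v : loc_ring) : loc_ring :=
  frac_lift (fun m w Ww => frac_lift (fun m' w' Ww' =>
    frac (m * m' : A^o) (rpredM Ww Ww')) v) u.

Lemma loc_mulE (m : A^o) w (Ww : w \in W) (m' : A^o) w' (Ww' : w' \in W) :
  loc_mul (frac m Ww) (frac m' Ww') = frac (m * m' : A^o) (rpredM Ww Ww').
Proof.
rewrite /loc_mul frac_liftE; last first.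
  move=> {}m {}w {}Ww n x Wx /frac_eq[t Wt e]; congr frac_lift.
  apply: functional_extensionality_dep => p; apply: functional_extensionality_dep => y.
  apply: functional_extensionality_dep => Wy; apply/frac_eq; exists t => //.
  transitivity ((y * p) * (t * (x * m))); first by rewrite /GRing.scale /=; ring.
  by rewrite [t * _]e /GRing.scale /=; ring.
rewrite frac_liftE // => n x Wx n' x' Wx' /frac_eq[t Wt e].
apply/frac_eq; exists t => //.
transitivity ((w * m) * (t * (x' * n))); first by rewrite /GRing.scale /=; ring.
by rewrite [t * _]e /GRing.scale /=; ring.
Qed.

Let frac_eq1 (m : A^o) w (Ww : w \in W) (m' : A^o) w' (Ww' : w' \in W) :
  w' * m = w * m' -> frac m Ww = frac m' Ww'.
Proof. by move=> e; apply/frac_eq; exists 1; rewrite ?rpred1 // [w' *: _]e. Qed.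

Let fracPE (P : loc_ring -> Prop) :
  (forall (m : A^o) w (Ww : w \in W), P (frac m Ww)) -> forall u, P u.
Proof. by move=> h u; have [m [w [Ww ->]]] := fracP u. Qed.

Lemma loc_mulA : associative loc_mul.
Proof.
elim/fracPE=> m w Ww; elim/fracPE=> n x Wx; elim/fracPE=> p y Wy.
by rewrite !loc_mulE; apply: frac_eq1; ring.
Qed.
Lemma loc_mulC : commutative loc_mul.
Proof.
elim/fracPE=> m w Ww; elim/fracPE=> n x Wx.
by rewrite !loc_mulE; apply: frac_eq1; ring.
Qed.
Lemma loc_mul1 : left_id loc_one loc_mul.
Proof. by elim/fracPE=> m w Ww; rewrite loc_mulE; apply: frac_eq1; ring. Qed.
Lemma loc_mulD : left_distributive loc_mul +%R.
Proof.
elim/fracPE=> m w Ww; elim/fracPE=> n x Wx; elim/fracPE=> p y Wy.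
rewrite [_ + _]fracD !loc_mulE [RHS]fracD; apply: frac_eq1.
by rewrite /GRing.scale /=; ring.
Qed.
HB.instance Definition _ :=
  GRing.Zmodule_isComPzRing.Build loc_ring loc_mulA loc_mulC loc_mul1 loc_mulD.

End LocalizationRing.

Section MultiplicativeSets.

Variable A : comNzRingType.

Definition powers (x : A) : {pred A} := fun a => `[< exists n, a = x ^+ n >].

Lemma powers_mulr_closed x : mulr_closed (powers x).
Proof.
split; first by apply/asboolP; exists 0; rewrite expr0.
move=> _ _ /asboolP[m ->] /asboolP[n ->]; apply/asboolP.
by exists (m + n)%N; rewrite exprD.
Qed.
HB.instance Definition _ x := GRing.isMulClosed.Build A (powers x) (powers_mulr_closed x).

Lemma powersX x n : x ^+ n \in powers x.
Proof. by apply/asboolP; exists n. Qed.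

Definition prime_compl (p : prime_idealr A) : {pred A} := fun a => a \notin p.

Lemma prime_compl_mulr_closed p : mulr_closed (prime_compl p).
Proof.
split; first by rewrite unfold_in /prime_compl idealr1.
move=> a b pa pb; rewrite unfold_in /prime_compl (prime_idealrM p a b) negb_or.
exact/andP.
Qed.
HB.instance Definition _ p :=
  GRing.isMulClosed.Build A (prime_compl p) (prime_compl_mulr_closed p).

End MultiplicativeSets.

Section DependentProduct.

Variables (A : nzRingType) (I : Type) (M : I -> lmodType A).

Definition dprod_module : Type := forall i, M i.
HB.instance Definition _ := gen_eqMixin dprod_module.
HB.instance Definition _ := gen_choiceMixin dprod_module.

Implicit Types u v w : dprod_module.

Let ext u v : (forall i, u i = v i) -> u = v.
Proof. exact: functional_extensionality_dep. Qed.

Definition dprod_add u v : dprod_module := fun i => u i + v i.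
Definition dprod_opp u : dprod_module := fun i => - u i.
Definition dprod_zero : dprod_module := fun i => 0.
Definition dprod_scale a u : dprod_module := fun i => a *: u i.

Lemma dprod_addA : associative dprod_add.
Proof. by move=> u v w; apply: ext => i; apply: addrA. Qed.
Lemma dprod_addC : commutative dprod_add.
Proof. by move=> u v; apply: ext => i; apply: addrC. Qed.
Lemma dprod_add0 : left_id dprod_zero dprod_add.
Proof. by move=> u; apply: ext => i; apply: add0r. Qed.
Lemma dprod_addN : left_inverse dprod_zero dprod_opp dprod_add.
Proof. by move=> u; apply: ext => i; apply: addNr. Qed.
HB.instance Definition _ :=
  GRing.isZmodule.Build dprod_module dprod_addA dprod_addC dprod_add0 dprod_addN.

Lemma dprod_scaleA a b u : dprod_scale a (dprod_scale b u) = dprod_scale (a * b) u.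
Proof. by apply: ext => i; apply: scalerA. Qed.
Lemma dprod_scale1 : left_id 1 dprod_scale.
Proof. by move=> u; apply: ext => i; apply: scale1r. Qed.
Lemma dprod_scaleDr : right_distributive dprod_scale +%R.
Proof. by move=> a u v; apply: ext => i; apply: scalerDr. Qed.
Lemma dprod_scaleDl u : {morph dprod_scale^~ u : a b / a + b}.
Proof. by move=> a b; apply: ext => i; apply: scalerDl. Qed.
HB.instance Definition _ := GRing.Zmodule_isLmodule.Build A dprod_module
  dprod_scaleA dprod_scale1 dprod_scaleDr dprod_scaleDl.

End DependentProduct.

Section HomologyMap.

Variables (A : nzRingType) (U V W U' V' W' : lmodType A).
Variables (f : {linear U -> V}) (g : {linear V -> W}).
Variables (f' : {linear U' -> V'}) (g' : {linear V' -> W'}).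
Variable phi : {linear V -> V'}.

(* The map induced in homology by the component [phi] of a chain map; it is
   independent of representatives by [homology_mapE]. *)
Definition homology_map (h : homology f g) : homology f' g' :=
  hclass f' g' (insubd 0 (phi (\val (repr (h : Quotient.quot (submod_pred (boundary_pred f g))))))).

Hypothesis phi_cycle : forall v, g v = 0 -> g' (phi v) = 0.
Hypothesis phi_boundary : forall u, exists u', f' u' = phi (f u).

Lemma homology_mapE (z : cycles g) (phiz : phi (\val z) \in ker_pred g') :
  homology_map (hclass f g z) = hclass f' g' (Cycle phiz).
Proof.
rewrite /homology_map; set r := repr _.
have phir : phi (\val r) \in ker_pred g'.
  by apply/eqP/phi_cycle/eqP; exact: valP r.
have [u er] : exists u, f u = \val (r - z).
  apply: (iffLR (@hclass_eq0 _ _ _ _ f g (r - z))).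
  rewrite linearB; apply/eqP; rewrite subr_eq0; apply/eqP.
  exact: (quot_classK (hclass f g z)).
have [u' eu'] := phi_boundary u.
apply/eqP; rewrite -subr_eq0 -linearB; apply/eqP/hclass_eq0; exists u'.
by rewrite eu' er !linearB /= val_insubd phir.
Qed.

End HomologyMap.

Arguments homology_map {A U V W U' V' W' f g f' g'} phi h.

(* The subsets of size i of {0, ..., l - 1}: the degree i basis of the exterior
   algebra on l generators. *)
Definition ksub l i := {I : {set 'I_l} | #|I| == i}.
HB.instance Definition _ l i := Finite.on (ksub l i).

(* When J = I + {j}, the sign (-1)^#{a in I | a < j}. *)
Definition ksign (A : pzRingType) l (I J : {set 'I_l}) : A :=
  (-1) ^+ #|[set a in I | [exists b in J :\: I, (a < b)%N]]|.

Section Koszul.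

Variables (A : comNzRingType) (l : nat).
Implicit Types x : 'I_l -> A.

Definition koszul i := {ffun ksub l i -> A^o}.

(* The differential e_J |-> \sum_(j in J) (-1)^#{a in J | a < j} x_j e_(J - j).
   It is meaningful for i = j.+1; for i = j it is zero, so that degree 0 needs
   no special case below. *)
Definition koszul_diff x i j (z : koszul i) : koszul j :=
  [ffun I : ksub l j => \sum_(J : ksub l i | val I \proper val J)
     ksign A (val I) (val J) * \prod_(a in val J :\: val I) x a * z J].

Lemma koszul_diff_is_linear x i j : linear (@koszul_diff x i j).
Proof.
move=> a u v; apply/ffunP => I; rewrite !ffunE scaler_sumr -big_split /=.
apply: eq_bigr => J _; rewrite !ffunE mulrDr; congr (_ + _).
by rewrite /GRing.scale /=; ring.
Qed.
HB.instance Definition _ x i j :=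
  GRing.isLinear.Build A (koszul i) (koszul j) _ (@koszul_diff x i j)
    (@koszul_diff_is_linear x i j).

Definition koszul_homology x i : lmodType A :=
  homology (@koszul_diff x i.+1 i) (@koszul_diff x i i.-1).

Definition pow_seq x n : 'I_l -> A := fun j => x j ^+ n.

(* e_I |-> (\prod_(i in I) x_i^(n - m)) e_I. *)
Definition koszul_trans x n m i (z : koszul i) : koszul i :=
  [ffun I : ksub l i => \prod_(a in val I) x a ^+ (n - m) * z I].

Lemma koszul_trans_is_linear x n m i : linear (@koszul_trans x n m i).
Proof.
move=> a u v; apply/ffunP => I; rewrite !ffunE mulrDr; congr (_ + _).
by rewrite /GRing.scale /=; ring.
Qed.
HB.instance Definition _ x n m i :=
  GRing.isLinear.Build A (koszul i) (koszul i) _ (@koszul_trans x n m i)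
    (@koszul_trans_is_linear x n m i).

Lemma koszul_trans_diff x n m i j (z : koszul i) : (m <= n)%N ->
  koszul_trans x n m (koszul_diff (pow_seq x n) j z) =
  koszul_diff (pow_seq x m) j (koszul_trans x n m z).
Proof.
move=> lemn; apply/ffunP => I; rewrite !ffunE mulr_sumr; apply: eq_bigr => J sIJ.
rewrite ffunE [\prod_(a in val J) _](big_setID (val I)) /= (finset.setIidPr (proper_sub sIJ)).
set P := \prod_(a in val I) _; set R := \prod_(a in _ :\: _) _.
set T := \prod_(a in _ :\: _) _; set U := \prod_(a in _ :\: _) _.
have -> : R = T * U; last by ring.
rewrite -big_split /=; apply: eq_bigr => a _.
by rewrite /pow_seq -exprD subnKC.
Qed.

Definition koszul_homology_trans x n m i :
    koszul_homology (pow_seq x n) i -> koszul_homology (pow_seq x m) i :=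
  homology_map (@koszul_trans x n m i).

End Koszul.

Arguments koszul_diff {A l} x i j z.
Arguments koszul_trans {A l} x n m i z.
Arguments koszul_homology_trans {A l} x n m i h.

Section Cech.

Variables (A : comNzRingType) (l : nat) (x : 'I_l -> A) (M : lmodType A).

Definition cech_prod (I : {set 'I_l}) : A := \prod_(a in I) x a.

Definition cech i : lmodType A :=
  dprod_module (fun I : ksub l i => loc (powers (cech_prod (val I))) M).

(* The component indexed by J is
   \sum_(j in J) (-1)^#{a in J | a < j} (image of c_(J - j)).
   It is meaningful for j = i.+1, and zero for i = j as above. *)
Definition cech_diff i j (c : cech i) : cech j :=
  fun J => \sum_(I : ksub l i | val I \proper val J)
    ksign A (val I) (val J) *: loc_map (powers (cech_prod (val J))) (c I).

Lemma powers_cech_prodP (I J : {set 'I_l}) : I \subset J ->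
  forall w, w \in powers (cech_prod I) ->
  exists t, t * w \in powers (cech_prod J).
Proof.
move=> sIJ _ /asboolP[n ->]; exists (cech_prod (J :\: I) ^+ n).
rewrite -exprMn; suff -> : cech_prod (J :\: I) * cech_prod I = cech_prod J.
  exact: powersX.
rewrite /cech_prod [RHS](big_setID I) /= mulrC; congr (_ * _).
by rewrite (finset.setIidPr sIJ).
Qed.

Lemma cech_diff_is_linear i j : linear (@cech_diff i j).
Proof.
move=> a u v; apply: functional_extensionality_dep => J.
transitivity (a *: @cech_diff i j u J + @cech_diff i j v J) => //.
rewrite /cech_diff scaler_sumr -big_split /=; apply: eq_bigr => I sIJ.
rewrite (_ : (a *: u + v) I = a *: u I + v I) // loc_map_is_linear.
  by rewrite scalerDr !scalerA mulrC.
exact: powers_cech_prodP (proper_sub sIJ).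
Qed.
HB.instance Definition _ i j :=
  GRing.isLinear.Build A (cech i) (cech j) _ (@cech_diff i j)
    (@cech_diff_is_linear i j).

Definition cech_cohomology i : lmodType A :=
  homology (@cech_diff i.-1 i) (@cech_diff i i.+1).

End Cech.

Arguments cech_diff {A l x M} i j c.

Section Sequences.

Variable A : comNzRingType.
Implicit Type s : seq A.

Definition weakly_proregular s : Prop :=
  forall m, (0 < m)%N -> exists2 n, (m <= n)%N &
  forall i, (0 < i)%N ->
  forall h : koszul_homology (pow_seq (tnth (in_tuple s)) n) i,
    koszul_homology_trans (tnth (in_tuple s)) n m i h = 0.

Definition cech_cohomology_seq s i (M : lmodType A) : lmodType A :=
  cech_cohomology (tnth (in_tuple s)) M i.

Definition parameter_sequence s : Prop :=
  [/\ ideal_gen s <> setT,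
      weakly_proregular s &
      forall p : prime_idealr A, ideal_gen s `<=` [set a | a \in p] ->
        ~ is_zero_module
            (loc (prime_compl p) (cech_cohomology_seq s (size s) A^o))].

Definition strong_parameter_sequence s : Prop :=
  forall i, (1 <= i <= size s)%N -> parameter_sequence (take i s).

Definition regular_sequence s : Prop :=
  ideal_gen s <> setT /\
  forall i, (i < size s)%N -> forall a,
    ideal_gen (take i s) (s`_i * a) -> ideal_gen (take i s) a.

End Sequences.

Definition cohen_macaulay (A : comNzRingType) : Prop :=
  forall s : seq A, strong_parameter_sequence s -> regular_sequence s.

Section EssentiallyOfFiniteType.

(* k-algebras are given by their structure morphism. *)

Definition finitely_generated_algebra (k : fieldType) (B : comNzRingType)
    (j : {rmorphism k -> B}) : Prop :=
  exists s : seq B, forall T : subringClosed B,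
    (forall a, j a \in T) -> {subset s <= T} -> forall b, b \in T.

Definition essentially_of_finite_type (k : fieldType) (S : comNzRingType)
    (iota : {rmorphism k -> S}) : Prop :=
  exists (B : comNzRingType) (j : {rmorphism k -> B}) (W : mulrClosed B)
         (theta : {rmorphism loc_ring W -> S}),
    [/\ finitely_generated_algebra j, bijective theta &
        forall a, theta (frac (j a : B^o) (rpred1 W)) = iota a].

End EssentiallyOfFiniteType.

Section KPlus.

Variables (k : fieldType) (S : comNzRingType) (iota : {rmorphism k -> S}).
Variable Q : ideal S.

Definition kplus_pred : {pred S} :=
  fun s => `[< exists a q, q \in Q /\ s = iota a + q >].

Lemma kplus_subring_closed : subring_closed kplus_pred.
Proof.
split.
- by apply/asboolP; exists 1, 0; rewrite rmorph1 addr0; split=> //; apply: rpred0.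
- move=> _ _ /asboolP[a [q [Qq ->]]] /asboolP[b [r [Qr ->]]]; apply/asboolP.
  exists (a - b), (q - r); split; last by rewrite rmorphB /=; ring.
  by rewrite -scaleN1r; apply: rpredD => //; apply: rpredZ.
move=> _ _ /asboolP[a [q [Qq ->]]] /asboolP[b [r [Qr ->]]]; apply/asboolP.
exists (a * b), (iota a * r + (iota b + r) * q); split; last by rewrite rmorphM /=; ring.
by apply: rpredD; [apply: (rpredZ (iota a) Qr)|apply: (rpredZ (iota b + r) Qq)].
Qed.
HB.instance Definition _ :=
  GRing.isSubringClosed.Build S kplus_pred kplus_subring_closed.

Record kplus := KPlus { kplus_val :> S; _ : kplus_val \in kplus_pred }.

HB.instance Definition _ := [isSub for kplus_val].
HB.instance Definition _ := [Choice of kplus by <:].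
HB.instance Definition _ := [SubChoice_isSubComNzRing of kplus by <:].

Lemma kplus_ideal q : q \in Q -> q \in kplus_pred.
Proof. by move=> Qq; apply/asboolP; exists 0, q; rewrite rmorph0 add0r. Qed.

Definition kplus_of_ideal q (Qq : q \in Q) : kplus := KPlus (kplus_ideal Qq).

End KPlus.

Lemma ideal_gen2_mem (S : comNzRingType) (Q : ideal S) (f g : S) :
  [set a : S | a \in Q] = ideal_gen [:: f; g] -> (f \in Q) * (g \in Q).
Proof.
move=> Qfg; have Qs q : q \in [:: f; g] -> q \in Q.
  by move=> sq; have : ideal_gen [:: f; g] q by [exact: ideal_gen_mem]; rewrite -Qfg.
by rewrite !Qs ?mem_head // inE mem_head orbT.
Qed.

(* Main.v *)
From HB Require Import structures.
From mathcomp Require Import all_boot all_order all_algebra.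
From mathcomp Require Import boolp classical_sets.
From mathcomp Require Import ring.
Require Import Defs.

(** Write [R = k + Q] with [Q = (f, g) S].  As [f] and [g] lie in the ideal [Q]
    of [S], which is contained in [R], multiplying an element of [S] by [f] or
    [g] brings it into [R]: localizing at [f], at [g] or at [f g] identifies [R]
    with [S], and hence [H^2_{f,g}(R) = H^2_{f,g}(S)] ([is_zero_cech2_kplus]).
    The three conditions on a parameter sequence are then checked as follows.

    - Weak proregularity.  The ring [S] is noetherian, by the Hilbert basis
      theorem, so [f, g] is weakly proregular on [S].  The ring [R] need not be
      noetherian, but a Koszul cycle over [R] which is killed by a transition map
      over [S] is killed over [R] by the next transition map, which multiplies
      the bounding element by [f g] ([weakly_proregular_kplus]).

    - Support.  Since [Q ^ 2] is contained in [(f, g) R], a prime [p] of [R]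
      over [(f, g) R] contains [Q], so that [t = a + q] with [a] a nonzero scalar
      for every [t] outside [p].  Each class of [H^2] is killed by a power of
      [q], hence [t] acts injectively on [H^2] ([cech2_null_cancel]) and
      localizing at [p] does not kill a nonzero [H^2].  Conversely [Q] itself is
      such a prime, so nonvanishing after localization gives [H^2 <> 0].

    - For the one-term sequence [f], the class of [1 / f] survives in
      [H^1_f(R)_p] as soon as [f] is a nonzerodivisor lying in [p]
      ([cech1_loc_neq0]).

    For the second assertion, if [H^2] were nonzero then [f, g] would be a regular
    sequence on the Cohen-Macaulay ring [R]; but [g (s f) = f (s g)] with [s f]
    and [s g] in [R] for every [s] in [S], and regularity then forces
    [s f = f r] with [r] in [R], that is [s = r] ([regular_kplus]).  So [R] would be
    all of [S], which is excluded.

    All computations in top Cech cohomology rest on one criterion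
    ([cech_class_eq0]): the class of [m / (x_1 ... x_l)^n] vanishes if and only if
    [(x_1 ... x_l)^N m] lies in [(x_1^(n+N), ..., x_l^(n+N)) M] for some [N]. *)

Set Implicit Arguments.
Unset Strict Implicit.
Unset Printing Implicit Defensive.

Import GRing.Theory.

Local Open Scope classical_set_scope.
Local Open Scope ring_scope.

(** * Finitely generated ideals *)

Section IdealGen.

Variable A : comNzRingType.
Implicit Types (s t : seq A) (a b : A).

Lemma ideal_gen0 s : ideal_gen s 0.
Proof. by exists (fun=> 0); rewrite big1 // => i _; rewrite mul0r. Qed.

Lemma ideal_genD s a b : ideal_gen s a -> ideal_gen s b -> ideal_gen s (a + b).
Proof.
move=> [c ->] [d ->]; exists (fun i => c i + d i).
by rewrite -big_split /=; apply: eq_bigr => i _; rewrite mulrDl.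
Qed.

Lemma ideal_genM s a b : ideal_gen s b -> ideal_gen s (a * b).
Proof.
move=> [c ->]; exists (fun i => a * c i).
by rewrite mulr_sumr; apply: eq_bigr => i _; rewrite mulrA.
Qed.

Lemma ideal_gen_sum s (I : Type) (r : seq I) (P : pred I) (F : I -> A) :
  (forall i, P i -> ideal_gen s (F i)) -> ideal_gen s (\sum_(i <- r | P i) F i).
Proof.
by move=> sF; elim/big_ind: _ => //; [exact: ideal_gen0|exact: ideal_genD].
Qed.

Lemma ideal_gen_sub s t :
  (forall a, a \in s -> ideal_gen t a) -> ideal_gen s `<=` ideal_gen t.
Proof.
move=> st _ [c ->]; apply: ideal_gen_sum => i _; apply: ideal_genM.
by apply: st; rewrite mem_nth.
Qed.

Lemma ideal_gen_mkseq_le (a : nat -> A) m n : (m <= n)%N ->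
  ideal_gen (mkseq a m) `<=` ideal_gen (mkseq a n).
Proof.
move=> lemn; apply: ideal_gen_sub => _ /mapP[i + ->].
rewrite mem_iota /= => ltim; apply: ideal_gen_mem; apply/mapP.
by exists i; rewrite // mem_iota /= (leq_trans ltim).
Qed.

Lemma ideal_gen2E a b c : ideal_gen [:: a; b] c <-> exists u v, c = u * a + v * b.
Proof.
split=> [[d ->]|[u [v ->]]].
  by exists (d ord0), (d (lift ord0 ord0)); rewrite !big_ord_recl big_ord0 addr0.
by apply: ideal_genD; apply: ideal_genM; apply: ideal_gen_mem; rewrite !inE eqxx ?orbT.
Qed.

Lemma ideal_gen1E a c : ideal_gen [:: a] c <-> exists u, c = u * a.
Proof.
split=> [[d ->]|[u ->]].
  by exists (d ord0); rewrite big_ord_recl big_ord0 addr0.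
by apply: ideal_genM; apply: ideal_gen_mem; rewrite mem_head.
Qed.

End IdealGen.

(** * Noetherian rings and the Hilbert basis theorem *)

(** The ascending chain condition for the chain of ideals
    [(a 0, ..., a n.-1)], in the form which is used both to prove the Hilbert basis
    theorem and to stop the chain of colon ideals below. *)
Definition noetherian (A : comNzRingType) : Prop :=
  forall a : nat -> A, exists n, ideal_gen (mkseq a n) (a n).

Lemma noetherian_field (k : fieldType) : noetherian k.
Proof.
move=> a; have [a0|a0] := eqVneq (a 0%N) 0.
  by exists 0%N; rewrite a0; exact: ideal_gen0.
exists 1%N; apply/ideal_gen1E; exists (a 1%N / a 0%N).
by rewrite mulfVK.
Qed.

(** Each [b] generates the same ideal as the image of its [a], so that a
    relation between the elements of [A] gives one between the elements of [B].
    Surjections are the case [u = v = 1], and localizations the case where [u] is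
    the inverse of a denominator and [v] that denominator. *)
Lemma noetherian_assoc_image (A B : comNzRingType) (phi : {rmorphism A -> B}) :
    (forall b, exists a, exists u v, b = u * phi a /\ phi a = v * b) ->
  noetherian A -> noetherian B.
Proof.
move=> /choice[lift liftP] noethA b.
have [n [c e]] := noethA (lift \o b); exists n.
have [u [v [-> _]]] := liftP (b n); apply: ideal_genM.
move: e => /= ->; rewrite rmorph_sum; apply: ideal_gen_sum => i _.
rewrite rmorphM; apply: ideal_genM.
have ltin : (i < n)%N by rewrite -[X in (_ < X)%N](size_mkseq (lift \o b)).
rewrite nth_mkseq //=; have [_ [w [_ ->]]] := liftP (b i); apply: ideal_genM.
by apply: ideal_gen_mem; apply/mapP; exists (i : nat); rewrite // mem_iota.
Qed.

(** If the sequence [p] never meets the ideal of its previous terms, the ideal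
    [I] that it generates is not finitely generated, and one can choose
    successively [q n] in [I], of least degree outside [(q 0, ..., q n.-1)].  As
    [A] is noetherian, some leading coefficient is a combination of the previous
    ones; subtracting from [q n] the same combination of the [q i], shifted to the
    degree of [q n], lowers the degree and contradicts the choice of [q n]. *)
Lemma hilbert_basis (A : comNzRingType) : noetherian A -> noetherian {poly A}.
Proof.
move=> noethA p; apply: contrapT => /forallNP pP.
pose I := [set q : {poly A} | exists n, ideal_gen (mkseq p n) q].
have ID q r : I q -> I r -> I (q + r).
  move=> [m qm] [n rn]; exists (maxn m n); apply: ideal_genD.
    exact: ideal_gen_mkseq_le (leq_maxl m n) _ qm.
  exact: ideal_gen_mkseq_le (leq_maxr m n) _ rn.
have IM q r : I r -> I (q * r) by move=> [n rn]; exists n; exact: ideal_genM.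
have I_not_fg (s : seq {poly A}) : (forall q, q \in s -> I q) ->
    exists q, I q /\ ~ ideal_gen s q.
  move=> sI; have [n sn] : exists n, forall q, q \in s -> ideal_gen (mkseq p n) q.
    elim: s sI => [|q s IHs] sI; first by exists 0%N.
    have [|n sn] := IHs; first by move=> r sr; apply: sI; rewrite inE sr orbT.
    have [m qm] := sI q (mem_head q s); exists (maxn m n) => r.
    rewrite inE => /orP[/eqP ->|/sn rn].
      exact: ideal_gen_mkseq_le (leq_maxl m n) _ qm.
    exact: ideal_gen_mkseq_le (leq_maxr m n) _ rn.
  exists (p n); split; last by move/(ideal_gen_sub sn)/pP.
  exists n.+1; apply: ideal_gen_mem; apply/mapP; exists n => //.
  by rewrite mem_iota /=.
have /choice[next nextP] (s : seq {poly A}) : exists q, (forall r, r \in s -> I r) ->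
    [/\ I q, ~ ideal_gen s q &
        forall r, I r -> ~ ideal_gen s r -> (size q <= size r)%N].
  have [sI|?] := pselect (forall r, r \in s -> I r); last by exists 0.
  have [q0 [Iq0 sq0]] := I_not_fg s sI.
  pose D d := `[< exists q, [/\ I q, ~ ideal_gen s q & size q = d] >].
  have exD : exists d, D d by exists (size q0); apply/asboolP; exists q0.
  case: (ex_minnP exD) => d /asboolP[q [Iq sq <-]] min_q; exists q => _.
  by split=> // r Ir sr; apply: min_q; apply/asboolP; exists r.
pose fix chosen n := if n is m.+1 then rcons (chosen m) (next (chosen m)) else [::].
pose q n := next (chosen n).
have chosenE n : chosen n = mkseq q n.
  by elim: n => // n IHn; rewrite mkseqS -IHn.
have chosenI n r : r \in chosen n -> I r.
  elim: n r => // n IHn r /=; rewrite mem_rcons inE => /orP[/eqP ->|]; last exact: IHn.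
  by have [] := nextP _ IHn.
have Iq n : I (q n) by have [] := nextP _ (chosenI n).
have q_new n : ~ ideal_gen (mkseq q n) (q n).
  by rewrite -chosenE; have [] := nextP _ (chosenI n).
have q_min n r : I r -> ~ ideal_gen (mkseq q n) r -> (size (q n) <= size r)%N.
  by rewrite -chosenE; have [_ _] := nextP _ (chosenI n); apply.
have size_q m n : (m <= n)%N -> (size (q m) <= size (q n))%N.
  move=> lemn; apply: q_min (Iq n) _ => /(ideal_gen_mkseq_le lemn).
  exact: q_new.
have q_neq0 n : q n != 0.
  by apply/eqP => q0; apply: (q_new n); rewrite q0; exact: ideal_gen0.
have [n] := noethA (fun n => lead_coef (q n)).
rewrite /ideal_gen /= size_mkseq => -[c e].
(* [r] has the same coefficient as [q n] in degree [d.-1], and degree at most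
   [d.-1]. *)
pose d := size (q n); pose r := \sum_(i < n) (c i)%:P * ('X^(d - size (q i)) * q i).
have mem_q (i : 'I_n) : q i \in mkseq q n.
  by apply/mapP; exists (i : nat); rewrite // mem_iota ltn_ord.
have rn : ideal_gen (mkseq q n) r.
  apply: ideal_gen_sum => i _; do 2!apply: ideal_genM.
  exact: ideal_gen_mem (mem_q i).
have Ir : I r.
  rewrite /r; elim/big_ind: _ => [||i _]; first by exists 0%N; exact: ideal_gen0.
    exact: ID.
  by apply: (IM); apply: (IM); exact: Iq.
have d_gt0 : (0 < d)%N by rewrite size_poly_gt0.
suff : (size (q n - r)%R <= d.-1)%N.
  apply/negP; rewrite -ltnNge prednK //; apply: q_min.
    by rewrite -mulN1r; apply: ID (Iq n) (IM _ _ Ir).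
  by move/ideal_genD/(_ rn); rewrite subrK; exact: q_new.
apply/leq_sizeP => j lej; rewrite coefB /r coef_sum.
have -> : (q n)`_j = if j == d.-1 then lead_coef (q n) else 0.
  case: eqVneq => [-> //|neqj]; apply: nth_default.
  by rewrite -/d -(prednK d_gt0) ltn_neqAle eq_sym neqj.
apply/eqP; rewrite subr_eq0; apply/eqP.
transitivity (\sum_(i < n) c i * (if j == d.-1 then lead_coef (q i) else 0)).
  case: eqP => _; last by rewrite big1 // => i _; rewrite mulr0.
  by rewrite e; apply: eq_bigr => i _; rewrite nth_mkseq.
apply: eq_bigr => i _; rewrite coefCM coefXnM; congr (_ * _).
have led : (size (q i) <= d)%N by apply: size_q; apply: ltnW.
have di_gt0 : (0 < size (q i))%N by rewrite size_poly_gt0.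
have -> : (j < d - size (q i))%N = false.
  apply/negbTE; rewrite -leqNgt (leq_trans _ lej) // -subn1.
  exact: leq_sub2l.
case: eqVneq => [->|neqj].
  rewrite lead_coefE; congr nth.
  by rewrite -!subn1 subnAC subKn.
have ltj : (d <= j)%N by rewrite -(prednK d_gt0) ltn_neqAle eq_sym neqj.
by rewrite nth_default // -{1}(subKn led) leq_sub2r.
Qed.

Section Image.

Variables (A B : comNzRingType) (phi : {rmorphism A -> B}).

Definition image_pred : {pred B} := fun b => `[< exists a, phi a = b >].

Lemma image_subring_closed : subring_closed image_pred.
Proof.
split; first by apply/asboolP; exists 1; rewrite rmorph1.
  move=> _ _ /asboolP[a <-] /asboolP[b <-]; apply/asboolP.
  by exists (a - b); rewrite rmorphB.
move=> _ _ /asboolP[a <-] /asboolP[b <-]; apply/asboolP.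
by exists (a * b); rewrite rmorphM.
Qed.
HB.instance Definition _ :=
  GRing.isSubringClosed.Build B image_pred image_subring_closed.

End Image.

(** By induction on the generators, an iterated polynomial ring over [k], which
    is noetherian, maps to [B] with an image that contains [k] and the
    generators. *)
Lemma noetherian_finitely_generated_algebra (k : fieldType) (B : comNzRingType)
    (j : {rmorphism k -> B}) :
  finitely_generated_algebra j -> noetherian B.
Proof.
move=> [s sP].
have [P [phi [noethP phi_j phi_s]]] : exists (P : comNzRingType) (phi : {rmorphism P -> B}),
    [/\ noetherian P, forall a, j a \in image_pred phi & {subset s <= image_pred phi}].
  elim: s {sP} => [|b s [P [phi [noethP phi_j phi_s]]]].
    exists k, j; split=> //; first exact: noetherian_field.
    by move=> a; apply/asboolP; exists a.
  have cphi : commr_rmorph phi b by move=> a; exact: mulrC.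
  exists {poly P}, (horner_morph cphi); split; first exact: hilbert_basis.
    move=> a; have /asboolP[c <-] := phi_j a; apply/asboolP; exists c%:P.
    exact: horner_morphC.
  move=> c; rewrite inE => /orP[/eqP ->|/phi_s/asboolP[d <-]]; apply/asboolP.
    by exists 'X; exact: horner_morphX.
  by exists d%:P; exact: horner_morphC.
apply: (noetherian_assoc_image (phi := phi)) noethP => b.
have /asboolP[a <-] : b \in image_pred phi by apply: sP.
by exists a, 1, 1; rewrite mul1r.
Qed.

Section LocalizationMorphism.

Variables (A : comNzRingType) (W : mulrClosed A).

Definition loc_inj (a : A) : loc_ring W := frac (a : A^o) (rpred1 W).

Lemma loc_inj_zmod_morphism : zmod_morphism loc_inj.
Proof.
move=> a b; apply/eqP; rewrite eq_sym subr_eq eq_sym; apply/eqP.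
rewrite [LHS]fracD; apply/frac_eq; exists 1; rewrite ?rpred1 //.
by rewrite /GRing.scale /=; ring.
Qed.

Lemma loc_inj_monoid_morphism : monoid_morphism loc_inj.
Proof.
split=> // a b; rewrite [RHS]loc_mulE; apply/frac_eq; exists 1; rewrite ?rpred1 //.
by rewrite /GRing.scale /=; ring.
Qed.

HB.instance Definition _ :=
  GRing.isZmodMorphism.Build A (loc_ring W) loc_inj loc_inj_zmod_morphism.
HB.instance Definition _ :=
  GRing.isMonoidMorphism.Build A (loc_ring W) loc_inj loc_inj_monoid_morphism.

Lemma fracE (a : A^o) w (Ww : w \in W) :
  (frac a Ww : loc_ring W) = (frac (1 : A^o) Ww : loc_ring W) * loc_inj a.
Proof.
rewrite [RHS]loc_mulE; apply/frac_eq; exists 1; rewrite ?rpred1 //.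
by rewrite /GRing.scale /=; ring.
Qed.

Lemma loc_injE (a : A^o) w (Ww : w \in W) :
  loc_inj a = loc_inj w * (frac a Ww : loc_ring W).
Proof.
rewrite [RHS]loc_mulE; apply/frac_eq; exists 1; rewrite ?rpred1 //.
by rewrite /GRing.scale /=; ring.
Qed.

End LocalizationMorphism.

Lemma noetherian_essentially_of_finite_type (k : fieldType) (S : comNzRingType)
    (iota : {rmorphism k -> S}) :
  essentially_of_finite_type iota -> noetherian S.
Proof.
move=> [B [j [W [theta [fgB [theta' _ thetaK] _]]]]].
apply: (noetherian_assoc_image (phi := theta \o @loc_inj B W)).
  move=> b; have [a [w [Ww e]]] := fracP (theta' b).
  exists a, (theta (frac (1 : B^o) Ww)), (theta (loc_inj W w)).
  rewrite /= -!rmorphM -fracE; split; first by rewrite -e thetaK.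
  by rewrite (loc_injE _ Ww) -e rmorphM /= thetaK.
exact: noetherian_finitely_generated_algebra fgB.
Qed.

(** * Faces of codimension one of a simplex *)

Lemma ksub_top l (J : ksub l l) : val J = [set: 'I_l]%SET.
Proof.
by apply/eqP; rewrite eqEcard finset.subsetT cardsT card_ord (eqP (valP J)) leqnn.
Qed.

Section Facets.

Variable l : nat.

Lemma facet_card (j : 'I_l.+1) : #|[set~ j]%SET| == l.
Proof. by rewrite cardsC1 card_ord. Qed.

(** The sets of [l] indices among [l + 1] are indexed by the missing one; this
    turns the differentials in and out of top degree into sums over the
    indices. *)
Definition facet (j : 'I_l.+1) : ksub l.+1 l := exist _ [set~ j]%SET (facet_card j).

Lemma facet_onto (J : ksub l.+1 l) : exists j, facet j = J.
Proof.
case: J => J cardJ; have /cards1P[j ej] : #|~: J| == 1%N.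
  by rewrite -(eqn_add2l #|J|) cardsC card_ord (eqP cardJ) addn1.
by exists j; apply: val_inj; rewrite /= -ej finset.setCK.
Qed.

Lemma sum_facet (V : nmodType) (F : ksub l.+1 l -> V) :
  \sum_J F J = \sum_j F (facet j).
Proof.
have /choice[g gK] := facet_onto.
rewrite (reindex facet) //; exists g => // j _.
have := congr1 val (gK (facet j)) => /= /finset.setC_inj.
exact: finset.set1_inj.
Qed.

Lemma facet_proper (j : 'I_l.+1) (J : ksub l.+1 l.+1) :
  val (facet j) \proper val J.
Proof.
by rewrite ksub_top properEcard finset.subsetT (eqP (facet_card j)) cardsT card_ord ltnSn.
Qed.

End Facets.

Lemma facetsD1 l (j : 'I_l.+1) : [set: 'I_l.+1]%SET :\: [set~ j]%SET = [set j]%SET.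
Proof. by rewrite finset.setTD finset.setCK. Qed.

Lemma ksign_facet (A : pzRingType) l (j : 'I_l.+1) :
  ksign A [set~ j]%SET [set: 'I_l.+1]%SET = (-1) ^+ j.
Proof.
rewrite /ksign facetsD1; congr (_ ^+ _).
transitivity #|[pred a : 'I_l.+1 | (a < j)%N]|; last first.
  rewrite -sum1_card -(big_ord_widen _ (fun=> 1%N)) ?sum1_card ?card_ord //.
  exact: ltnW.
apply: eq_card => a; rewrite !inE; apply/andP/idP.
  by move=> [_ /existsP[b]]; rewrite inE => /andP[/eqP ->].
move=> ltaj; split; first by rewrite neq_ltn ltaj.
by apply/existsP; exists j; rewrite inE eqxx.
Qed.

(** * Weak proregularity of sequences of length one and two *)

Section Koszul.

Variable A : comNzRingType.

Lemma koszul_homology_trans_eq0 l (x : 'I_l -> A) n m i :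
    (m <= n)%N ->
    (forall z : koszul A l i, koszul_diff (pow_seq x n) i i.-1 z = 0 ->
       exists u, koszul_diff (pow_seq x m) i.+1 i u = koszul_trans x n m i z) ->
  forall h : koszul_homology (pow_seq x n) i, koszul_homology_trans x n m i h = 0.
Proof.
move=> lemn bd h; have [z ->] := hclassK h.
have cyc (v : koszul A l i) : koszul_diff (pow_seq x n) i i.-1 v = 0 ->
    koszul_diff (pow_seq x m) i i.-1 (koszul_trans x n m i v) = 0.
  by move=> v0; rewrite -koszul_trans_diff // v0 linear0.
have zcyc : koszul_diff (pow_seq x n) i i.-1 (\val z) = 0 by apply/eqP/(valP z).
have tz : koszul_trans x n m i (\val z) \in
    ker_pred (koszul_diff (pow_seq x m) i i.-1) by apply/eqP/cyc.
rewrite /koszul_homology_trans (homology_mapE cyc _ tz); last first.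
  by move=> u; exists (koszul_trans x n m i.+1 u); exact/esym/koszul_trans_diff.
have [_ h0] := @hclass_eq0 _ _ _ _ (@koszul_diff _ _ (pow_seq x m) i.+1 i) _ (Cycle tz).
by apply: h0; exact: bd.
Qed.

Lemma koszul_gt l i (z : koszul A l i) : (l < i)%N -> z = 0.
Proof.
move=> ltli; apply/ffunP => J; suff : (i <= l)%N by rewrite leqNgt ltli.
by rewrite -(eqP (valP J)) -[X in (_ <= X)%N]card_ord max_card.
Qed.

Lemma koszul_diff_top l (x : 'I_l.+1 -> A) (c : A) (j : 'I_l.+1) :
  koszul_diff x l.+1 l [ffun=> c] (facet j) = (-1) ^+ j * x j * c.
Proof.
pose T : ksub l.+1 l.+1 := exist _ [set: _]%SET (introT eqP (etrans (cardsT _) (card_ord _))).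
rewrite ffunE (big_pred1 T) => [|J]; last first.
  rewrite facet_proper; apply/esym/eqP/val_inj; exact: ksub_top.
by rewrite ffunE ksign_facet facetsD1 finset.big_set1.
Qed.

Lemma koszul_top_const l (z : koszul A l l) : exists c, z = [ffun=> c].
Proof.
pose T : ksub l l := exist _ [set: _]%SET (introT eqP (etrans (cardsT _) (card_ord _))).
exists (z T); apply/ffunP => J; rewrite ffunE; congr (z _); apply: val_inj.
exact: ksub_top.
Qed.

Lemma koszul_diff_top_inj l (x : 'I_l.+1 -> A) (z : koszul A l.+1 l.+1) :
  GRing.lreg (x ord0) -> koszul_diff x l.+1 l z = 0 -> z = 0.
Proof.
have [c ->] := koszul_top_const z => reg_x /ffunP/(_ (facet ord0)).
rewrite koszul_diff_top ffunE mul1r => xc0.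
by apply/ffunP => J; rewrite !ffunE; apply: reg_x; rewrite mulr0.
Qed.

(** The facet [facet ord0] is the singleton of the index [1], and
    [facet ord_max] that of [0]. *)
Lemma koszul_diff2 (x : 'I_2 -> A) (z : koszul A 2 1) (I : ksub 2 0) :
  koszul_diff x 1 0 z I = x ord_max * z (facet ord0) + x ord0 * z (facet ord_max).
Proof.
have I0 : val I = finset.set0 by apply/eqP; rewrite -cards_eq0; exact: (valP I).
rewrite ffunE (eq_bigl xpredT) => [|J]; last first.
  by rewrite I0 properEcard finset.sub0set cards0 (eqP (valP J)).
rewrite sum_facet !big_ord_recl big_ord0 addr0 I0.
have sgn J : ksign A finset.set0 J = 1.
  rewrite /ksign (_ : [set a in _ | _]%SET = finset.set0) ?cards0 //.
  by apply/finset.setP => a; rewrite !inE.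
rewrite !sgn !mul1r !finset.setD0 /=; congr (_ * _ + _ * z _).
- by rewrite big_mkcond !big_ord_recl big_ord0 !inE /= mul1r mulr1; congr x; apply: val_inj.
- by rewrite big_mkcond !big_ord_recl big_ord0 !inE /= !mulr1.
- by apply: val_inj => /=; congr (~: [set _])%SET; apply: val_inj.
Qed.

Lemma weakly_proregular1 (x : A) : GRing.lreg x -> weakly_proregular [:: x].
Proof.
move=> reg_x m _; exists m => // i i_gt0; apply: koszul_homology_trans_eq0 => // z.
case: i i_gt0 z => // -[|i] _ z dz; exists 0.
  rewrite [z](koszul_diff_top_inj (l := 0) _ dz) ?linear0 //; exact: lregX.
by rewrite [z]koszul_gt ?linear0.
Qed.

(** Only the first Koszul homology matters, the second one being zero when [x]
    is a nonzerodivisor; there the cycle [(a, b)] has to become the boundary of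
    [c]. *)
Lemma weakly_proregular2 (x y : A) :
    GRing.lreg x ->
    (forall m, exists2 n, (m <= n)%N & forall a b, a * x ^+ n + b * y ^+ n = 0 ->
       exists c, x ^+ (n - m) * a = - (y ^+ m * c) /\ y ^+ (n - m) * b = x ^+ m * c) ->
  weakly_proregular [:: x; y].
Proof.
move=> reg_x H1 m _; have [n lemn killed] := H1 m; exists n => // i i_gt0.
apply: koszul_homology_trans_eq0 => // z.
case: i i_gt0 z => // -[|[|i]] _ z dz; last 2 first.
- exists 0; rewrite [z](koszul_diff_top_inj (l := 1) _ dz) ?linear0 //; exact: lregX.
- by exists 0; rewrite [z]koszul_gt ?linear0.
have := koszul_diff2 (pow_seq (tnth (in_tuple [:: x; y])) n) z
          (exist _ finset.set0 (introT eqP (cards0 _))).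
rewrite [koszul_diff _ _ _ _]dz ffunE addrC /pow_seq !(tnth_nth 0) /=.
rewrite (mulrC (x ^+ n)) (mulrC (y ^+ n)) => /esym/killed[c [xa yb]].
exists [ffun=> c]; apply/ffunP => J; have [j <-] := facet_onto J.
rewrite [LHS]koszul_diff_top [RHS]ffunE /pow_seq.
have [-> | ->] : j = ord0 \/ j = ord_max.
  by case: j => -[|[|//]] lt; [left|right]; apply: val_inj.
  rewrite (_ : val (facet ord0) = [set ord_max]%SET); last first.
    by apply/finset.setP => -[[|[|//]] ?]; rewrite !inE.
  by rewrite finset.big_set1 !(tnth_nth 0) /= mul1r yb.
rewrite (_ : val (facet ord_max) = [set ord0]%SET); last first.
  by apply/finset.setP => -[[|[|//]] ?]; rewrite !inE.
by rewrite finset.big_set1 !(tnth_nth 0) /= xa expr1 mulN1r mulNr.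
Qed.

End Koszul.

(** A sequence picked out of the successive jumps of a chain which does not
    stop would violate [noetherian]. *)
Lemma noetherian_acc (A : comNzRingType) (I : nat -> set A) :
    noetherian A ->
    (forall n, I n `<=` I n.+1) ->
    (forall n a b, I n a -> I n b -> I n (a + b)) ->
    (forall n a b, I n b -> I n (a * b)) ->
    (forall n, I n 0) ->
  exists N, forall n, I n `<=` I N.
Proof.
move=> noethA IS ID IM I0.
have Ile m n : (m <= n)%N -> I m `<=` I n.
  elim: n => [|n IHn]; first by rewrite leqn0 => /eqP ->.
  by rewrite leq_eqVlt => /orP[/eqP -> //|lemn] a /(IHn lemn)/IS.
apply: contrapT => /forallNP unstable.
have /choice[step stepP] N : exists na : nat * A, I na.1 na.2 /\ ~ I N na.2.
  have /existsNP[n /existsNP[a /not_implyP[Ia NIa]]] := unstable N.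
  by exists (n, a).
pose N := fix N k := if k is j.+1 then maxn (N j) (step (N j)).1 else 0%N.
have leN : {homo N : i k / (i <= k)%N >-> (i <= k)%N}.
  by apply: homo_leq => [//|? ? ?|j]; [exact: leq_trans|exact: leq_maxl].
have [k [c e]] := noethA (fun k => (step (N k)).2).
have [_] := stepP (N k); apply; rewrite e.
apply: (big_ind (I (N k))) => // [|i _]; first exact: ID.
have ltik : (i < k)%N.
  by rewrite -[X in (_ < X)%N](size_mkseq (fun k => (step (N k)).2)).
apply: IM; rewrite nth_mkseq //; apply: (Ile (N i.+1)); first exact: leN.
by apply: (Ile (step (N i)).1); [exact: leq_maxr|have [] := stepP (N i)].
Qed.

(** The colon ideals [(y^m : x^n)] increase with [n], so they are all contained in
    [(y^m : x^N)] for some [N].  If [a x^n + b y^n = 0] with [n >= m] then [a] is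
    in [(y^m : x^n)], hence [x^N a] is a multiple of [y^m]; the relation for [b]
    follows by cancelling [y^m]. *)
Lemma noetherian_proregular_pair (A : comNzRingType) (x y : A) m :
    noetherian A -> GRing.lreg y ->
  exists2 n, (m <= n)%N & forall a b, a * x ^+ n + b * y ^+ n = 0 ->
    exists c, x ^+ (n - m) * a = - (y ^+ m * c) /\ y ^+ (n - m) * b = x ^+ m * c.
Proof.
move=> noethA reg_y.
have [||||N stable] := @noetherian_acc A
  (fun n => [set a | exists d, a * x ^+ n = d * y ^+ m]) noethA.
- by move=> n a [d e]; exists (d * x); rewrite exprSr mulrA e; ring.
- by move=> n a b [d ea] [e eb]; exists (d + e); rewrite mulrDl ea eb mulrDl.
- by move=> n a b [d eb]; exists (a * d); rewrite -mulrA eb mulrA.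
- by move=> n; exists 0; rewrite !mul0r.
exists (N + m)%N; first exact: leq_addl.
move=> a b /eqP; rewrite addnK addr_eq0 => /eqP e.
have [|d ed] := stable (N + m)%N a.
  by exists (- b * y ^+ N); rewrite e exprD; ring.
exists (- d); split; first by rewrite mulrC ed; ring.
have reg_ym : GRing.lreg (y ^+ m) by exact: lregX.
apply: reg_ym => /=; transitivity (- (a * x ^+ (N + m))).
  by rewrite e exprD; ring.
by rewrite exprD mulrA ed; ring.
Qed.

(** * Cech cohomology in top degree *)

Section Fractions.

Variables (A : comNzRingType) (W : mulrClosed A) (M : lmodType A).

Lemma frac_eq1 (m : M) w (Ww : w \in W) m' w' (Ww' : w' \in W) :
  w' *: m = w *: m' -> frac m Ww = frac m' Ww'.
Proof. by move=> e; apply/frac_eq; exists 1; rewrite ?rpred1 ?e. Qed.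

Lemma frac_sum I (r : seq I) (F : I -> M) w (Ww : w \in W) :
  \sum_(i <- r) frac (F i) Ww = frac (\sum_(i <- r) F i) Ww.
Proof.
elim: r => [|i r IHr]; first by rewrite !big_nil frac0; apply: frac_eq1; rewrite !scaler0.
rewrite !big_cons IHr fracD; apply: frac_eq1.
by rewrite -scalerDr scalerA.
Qed.

Lemma is_zero_locP :
  is_zero_module (loc W M) <-> forall m : M, exists2 t, t \in W & t *: m = 0.
Proof.
split=> [M0 m|M0 u].
  have := M0 (frac m (rpred1 W)); rewrite frac0 => /frac_eq[t Wt].
  by rewrite scaler0 scale1r scaler0 => tm; exists t.
have [m [w [Ww ->]]] := fracP u; have [t Wt tm] := M0 m.
by rewrite frac0; apply/frac_eq; exists t; rewrite // scaler0 scale1r scaler0.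
Qed.

End Fractions.

Section TopCechCohomology.

Variables (A : comNzRingType) (l : nat) (x : 'I_l.+1 -> A) (M : lmodType A).

Let P := \prod_j x j.
Let P_ (j : 'I_l.+1) := cech_prod x (val (facet j)).

Let full : ksub l.+1 l.+1 :=
  exist _ [set: _]%SET (introT eqP (etrans (cardsT _) (card_ord _))).

Lemma cech_prod_top (J : ksub l.+1 l.+1) : cech_prod x (val J) = P.
Proof. by rewrite /cech_prod ksub_top; apply: eq_bigl => a; rewrite inE. Qed.

Lemma cech_prod_facet j : P = x j * P_ j.
Proof.
by rewrite /P (bigD1 j) //=; congr (_ * _); apply: eq_bigl => a; rewrite !inE.
Qed.

(** There is only one set of [l + 1] indices, so that this is the fraction
    [m / P^n]. *)
Definition cech_top_frac n (m : M) : cech x M l.+1 :=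
  fun J => frac m (powersX (cech_prod x (val J)) n).

Lemma cech_top_frac_surj (c : cech x M l.+1) : exists n m, c = cech_top_frac n m.
Proof.
have [m [w [Ww cE]]] := fracP (c full).
have /asboolP[n wE] := Ww; exists n, m.
apply: functional_extensionality_dep => J.
have -> : J = full by apply: val_inj; exact: ksub_top.
by rewrite cE; apply: frac_eq1; rewrite wE.
Qed.

Lemma cech_diff_topE (u : cech x M l) J :
  cech_diff l l.+1 u J =
  \sum_(j < l.+1) (-1) ^+ j *: loc_map (powers (cech_prod x (val J))) (u (facet j)).
Proof.
rewrite /cech_diff (eq_bigl xpredT) => [|I]; last first.
  by have [j <-] := facet_onto I; rewrite facet_proper.
rewrite sum_facet; apply: eq_bigr => j _; congr (_ *: _).
by rewrite ksub_top -ksign_facet.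
Qed.

Lemma loc_map_facet j (J : ksub l.+1 l.+1) n (m : M) (Wn : P_ j ^+ n \in powers (P_ j)) :
  loc_map (powers (cech_prod x (val J))) (frac m Wn) =
  frac (x j ^+ n *: m) (powersX (cech_prod x (val J)) n).
Proof.
have W12 : forall w, w \in powers (P_ j) -> exists t, t * w \in powers (cech_prod x (val J)).
  by apply: powers_cech_prodP; exact: proper_sub (facet_proper j J).
have Wt : x j ^+ n * P_ j ^+ n \in powers (cech_prod x (val J)).
  by rewrite -exprMn -cech_prod_facet -(cech_prod_top J) powersX.
rewrite (loc_mapE W12 _ _ Wt); apply: frac_eq1.
by rewrite cech_prod_top (cech_prod_facet j) exprMn.
Qed.

(** Written over a common denominator, a boundary is a sum of fractions
    [x_j^K c_j / P^K]; comparing it with [m / P^n] and multiplying by suitable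
    powers of the [P_ j = P / x_j] gives the powers [x_j^(n+N)].  Conversely
    [P^N m / P^(n+N)] is then the sum of the images of [c_j / P_j^(n+N)]. *)
Lemma cech_top_boundaryP n (m : M) :
  (exists u, cech_diff l l.+1 u = cech_top_frac n m) <->
  exists N, exists c, P ^+ N *: m = \sum_(j < l.+1) x j ^+ (n + N) *: c j.
Proof.
split=> [[u uE]|[N [c mE]]]; last first.
  have /choice[g gK] := @facet_onto l.
  exists (fun I => frac ((-1) ^+ g I *: c (g I)) (powersX (cech_prod x (val I)) (n + N))).
  apply: functional_extensionality_dep => J; rewrite cech_diff_topE.
  under eq_bigr => j _ do rewrite loc_map_facet fracZ.
  rewrite frac_sum; apply: frac_eq1; rewrite cech_prod_top exprD -scalerA mE.
  congr (_ *: _); apply: eq_bigr => j _.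
  have -> : g (facet j) = j.
    have := congr1 val (gK (facet j)) => /= /finset.setC_inj.
    exact: finset.set1_inj.
  by rewrite !scalerA mulrAC -expr2 sqrr_sign mul1r.
have /choice[r rE] j : exists nm : nat * M,
    u (facet j) = frac nm.2 (powersX (P_ j) nm.1).
  have [m' [w [Ww ->]]] := fracP (u (facet j)).
  have /asboolP[e wE] := Ww; exists (e, m'); apply: frac_eq1 => /=.
  by rewrite wE.
pose K := \max_j (r j).1.
pose c (j : 'I_l.+1) := (-1) ^+ j *: (P_ j ^+ (K - (r j).1) *: (r j).2).
have uE' j : u (facet j) =
    frac (P_ j ^+ (K - (r j).1) *: (r j).2) (powersX (P_ j) K).
  rewrite rE; apply: frac_eq1; rewrite scalerA -exprD subnKC //.
  exact: (leq_bigmax j).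
have := congr1 (fun v => v full) uE; rewrite cech_diff_topE.
under eq_bigr => j _ do rewrite uE' loc_map_facet fracZ.
rewrite frac_sum => /frac_eq[_ /asboolP[s ->]]; rewrite cech_prod_top => e.
exists (s + K)%N, (fun j => P_ j ^+ (s + n) *: c j).
rewrite exprD -scalerA -e scaler_sumr scaler_sumr; apply: eq_bigr => j _.
rewrite /c !scalerA; congr (_ *: _).
by rewrite (cech_prod_facet j) !exprMn !exprD; ring.
Qed.

Lemma cech_top_cycle (c : cech x M l.+1) :
  c \in ker_pred (cech_diff l.+1 l.+2 : cech x M l.+1 -> cech x M l.+2).
Proof.
apply/eqP/functional_extensionality_dep => J; suff : (l.+2 <= l.+1)%N by rewrite ltnn.
by rewrite -{1}(eqP (valP J)) -[X in (_ <= X)%N]card_ord max_card.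
Qed.

Definition cech_class n (m : M) : cech_cohomology x M l.+1 :=
  hclass _ _ (Cycle (cech_top_cycle (cech_top_frac n m))).

Lemma cech_class_surj h : exists n m, h = cech_class n m.
Proof.
have [z ->] := hclassK h; have [n [m zE]] := cech_top_frac_surj (\val z).
by exists n, m; congr (hclass _ _ _); apply: val_inj.
Qed.

Lemma cech_classZ a n m : a *: cech_class n m = cech_class n (a *: m).
Proof.
rewrite /cech_class -linearZ; congr (hclass _ _ _); apply: val_inj.
by apply: functional_extensionality_dep => J; exact: fracZ.
Qed.

Lemma cech_class_eq0 n (m : M) : cech_class n m = 0 <->
  exists N, exists c, P ^+ N *: m = \sum_(j < l.+1) x j ^+ (n + N) *: c j.
Proof. by rewrite -cech_top_boundaryP; exact: hclass_eq0. Qed.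

(** Every class of top degree is a [cech_class], so that the vanishing of the
    module and of its localizations is decided by [cech_class_eq0]. *)
Lemma is_zero_cech_top :
  is_zero_module (cech_cohomology x M l.+1) <->
  forall n (m : M), exists N, exists c, P ^+ N *: m = \sum_(j < l.+1) x j ^+ (n + N) *: c j.
Proof.
split=> [H0 n m|H0 h]; first by apply/cech_class_eq0; exact: H0.
by have [n [m ->]] := cech_class_surj h; apply/cech_class_eq0.
Qed.

Lemma is_zero_loc_cech_top (W : mulrClosed A) :
  is_zero_module (loc W (cech_cohomology x M l.+1)) <->
  forall n (m : M), exists2 t, t \in W &
    exists N, exists c, P ^+ N *: (t *: m) = \sum_(j < l.+1) x j ^+ (n + N) *: c j.
Proof.
rewrite is_zero_locP; split=> [H0 n m|H0 h].
  have [t Wt] := H0 (cech_class n m); rewrite cech_classZ => /cech_class_eq0 ?.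
  by exists t.
have [n [m ->]] := cech_class_surj h; have [t Wt tm] := H0 n m.
by exists t; rewrite // cech_classZ; apply/cech_class_eq0.
Qed.

End TopCechCohomology.

(** * Sequences of length one and two *)

Section CechPair.

Variables (A : comNzRingType) (x y : A).

(** Vanishing of the class of [a / (x y)^n] in [H^2_{x,y}(A)]. *)
Definition cech2_null n (a : A) : Prop :=
  exists N, ideal_gen [:: x ^+ (n + N); y ^+ (n + N)] ((x * y) ^+ N * a).

Lemma cech2_nullP n (a : A^o) (s := [:: x; y]) :
  cech2_null n a <->
  exists N, exists c : 'I_2 -> A^o,
    (\prod_(j < 2) tnth (in_tuple s) j) ^+ N *: a =
    \sum_(j < 2) tnth (in_tuple s) j ^+ (n + N) *: c j.
Proof.
split=> [[N /ideal_gen2E[u [v e]]]|[N [c e]]]; exists N.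
  exists (fun j => if j == ord0 then u else v).
  rewrite !big_ord_recl !big_ord0 !(tnth_nth 0) /= mulr1 addr0.
  by rewrite [LHS]e /GRing.scale /= (mulrC u) (mulrC v).
apply/ideal_gen2E; exists (c ord0), (c (lift ord0 ord0)); move: e.
rewrite !big_ord_recl !big_ord0 !(tnth_nth 0) /= mulr1 addr0 => e.
by rewrite [LHS]e /GRing.scale /= (mulrC (x ^+ _)) (mulrC (y ^+ _)).
Qed.

Lemma is_zero_cech2 :
  is_zero_module (cech_cohomology_seq [:: x; y] 2 A^o) <->
  forall n a, cech2_null n a.
Proof.
rewrite /cech_cohomology_seq (@is_zero_cech_top A 1).
by split=> H n a; apply/cech2_nullP.
Qed.

Lemma is_zero_loc_cech2 (W : mulrClosed A) :
  is_zero_module (loc W (cech_cohomology_seq [:: x; y] 2 A^o)) <->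
  forall n a, exists2 t, t \in W & cech2_null n (t * a).
Proof.
rewrite /cech_cohomology_seq (@is_zero_loc_cech_top A 1).
by split=> H n a; have [t Wt ta] := H n a; exists t => //; apply/cech2_nullP.
Qed.

(** In each term of the binomial expansion one of the two exponents is at least
    [k]. *)
Lemma ideal_gen_expr2 u v k :
  ideal_gen [:: x ^+ k; y ^+ k] ((u * x + v * y) ^+ (k + k)).
Proof.
set s := [:: _; _]; have memX w z j : z ^+ k \in s -> (k <= j)%N -> ideal_gen s ((w * z) ^+ j).
  move=> sz lekj; rewrite -(subnK lekj) exprD [(w * z) ^+ k]exprMn mulrA.
  by apply: ideal_genM; exact: ideal_gen_mem.
rewrite exprDn; apply: ideal_gen_sum => i _; rewrite -mulr_natl; apply: ideal_genM.
have [leki|ltik] := leqP k i.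
  by apply: ideal_genM; apply: memX; rewrite // !inE eqxx orbT.
rewrite mulrC; apply: ideal_genM; apply: memX; first by rewrite !inE eqxx.
by rewrite -(addnBA _ (ltnW ltik)) leq_addr.
Qed.

(** An element [q] of [(x, y)] acts nilpotently on each class, so that [a + q]
    acts injectively when [a] is a unit: with [K = n + N] the power [q^(2K)] lies in
    [(x^K, y^K)], and [a + q] divides [a^(2K) - (- q)^(2K)]. *)
Lemma cech2_null_unit n (r a b u v : A) : b * a = 1 ->
  cech2_null n ((a + (u * x + v * y)) * r) -> cech2_null n r.
Proof.
move=> ba1 [N]; set q := u * x + v * y => tr; exists N.
pose K := (n + N)%N; pose M := (K + K)%N.
have -> : (x * y) ^+ N * r =
    b ^+ M * ((\sum_(i < M) a ^+ (M.-1 - i) * (- q) ^+ i) * ((x * y) ^+ N * ((a + q) * r)))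
    + b ^+ M * ((x * y) ^+ N * r) * q ^+ M.
  have -> : q ^+ M = (- q) ^+ M by rewrite exprNn -signr_odd oddD addbb expr0 mul1r.
  transitivity (b ^+ M * ((x * y) ^+ N * r) * (a ^+ M - (- q) ^+ M + (- q) ^+ M)).
    by rewrite subrK mulrAC -exprMn ba1 expr1n mul1r.
  by rewrite [a ^+ M - _]subrXX opprK; ring.
apply: ideal_genD; apply: ideal_genM; first exact: ideal_genM.
exact: ideal_gen_expr2.
Qed.

End CechPair.

(** If [t] kills the class of [1 / x] then [t x^N = x^(N+1) c] for some [N] and
    [c], so that [t = x c] lies in [p]. *)
Lemma cech1_loc_neq0 (A : comNzRingType) (x : A) (p : prime_idealr A) :
    GRing.lreg x -> x \in p ->
  ~ is_zero_module (loc (prime_compl p) (cech_cohomology_seq [:: x] 1 A^o)).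
Proof.
move=> reg_x px; rewrite /cech_cohomology_seq (@is_zero_loc_cech_top A 0).
move=> /(_ 1%N 1)[t + [N [c]]].
rewrite !big_ord_recl !big_ord0 mulr1 addr0 !(tnth_nth 0) /= exprS.
have reg_xN : GRing.lreg (x ^+ N) by exact: lregX.
move=> + e.
have -> : t = x * c ord0 by apply: reg_xN; rewrite /= -[t]mulr1 [LHS]e /GRing.scale /=; ring.
by rewrite unfold_in /prime_compl mulrC idealMr.
Qed.

(** * The ring k + Q *)

Section KPlusPair.

Variables (k : fieldType) (S : idomainType) (iota : {rmorphism k -> S}).
Variable Q : ideal S.
Let R := kplus iota Q.
Variables x y : R.
Hypothesis hQ : [set a : S | a \in Q] = ideal_gen [:: val x; val y].

Lemma kplus_valD (a b : R) : val (a + b) = val a + val b.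
Proof. by []. Qed.

Lemma kplus_valN (a : R) : val (- a) = - val a.
Proof. by []. Qed.

Lemma kplus_valM (a b : R) : val (a * b) = val a * val b.
Proof. by []. Qed.

Lemma kplus_valX (a : R) n : val (a ^+ n) = val a ^+ n.
Proof. exact: rmorphXn. Qed.

Let kplus_valE := (kplus_valD, kplus_valN, kplus_valM, kplus_valX).

Lemma kplus_lift (q : S) : q \in Q -> exists r : R, val r = q.
Proof. by move=> Qq; exists (kplus_of_ideal iota Qq). Qed.

Lemma mem_kplus_ideal q : q \in Q <-> exists u v, q = u * val x + v * val y.
Proof.
by rewrite -ideal_gen2E -hQ.
Qed.

Lemma kplus_ideal_x (s : S) : s * val x \in Q.
Proof. by apply/mem_kplus_ideal; exists s, 0; rewrite mul0r addr0. Qed.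

Lemma kplus_ideal_y (s : S) : s * val y \in Q.
Proof. by apply/mem_kplus_ideal; exists 0, s; rewrite mul0r add0r. Qed.

Lemma kplus_lreg (r : R) : val r != 0 -> GRing.lreg r.
Proof.
move=> r_neq0 a b /(congr1 val); rewrite !kplus_valE => /(mulfI r_neq0) ab.
exact: val_inj.
Qed.

(** The coefficients of a relation over [S] at the level [N] need not be in [R],
    but those at the level [N + 1] are multiples of [x] and [y], hence in [Q]. *)
Lemma cech2_null_kplus n (r : R) :
  cech2_null x y n r <-> cech2_null (val x) (val y) n (val r).
Proof.
split=> [[N /ideal_gen2E[u [v e]]]|[N /ideal_gen2E[u [v e]]]].
  exists N; apply/ideal_gen2E; exists (val u), (val v).
  by move/(congr1 val): e; rewrite !kplus_valE.
have [u' u'E] := kplus_lift (kplus_ideal_y u).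
have [v' v'E] := kplus_lift (kplus_ideal_x v).
exists N.+1; apply/ideal_gen2E; exists u', v'; apply: val_inj.
rewrite !kplus_valE u'E v'E.
by rewrite !addnS !exprS -mulrA [_ ^+ N * _]e; ring.
Qed.

(** A fraction [a / (x y)^n] over [S] is [a x y / (x y)^(n+1)], and [a x y] is in
    [R]. *)
Lemma is_zero_cech2_kplus :
  is_zero_module (cech_cohomology_seq [:: x; y] 2 R^o) <->
  is_zero_module (cech_cohomology_seq [:: val x; val y] 2 S^o).
Proof.
rewrite !is_zero_cech2; split=> H n a; last exact/cech2_null_kplus.
have [r rE] := kplus_lift (kplus_ideal_x (a * val y)).
have /cech2_null_kplus := H n.+1 r; rewrite rE => -[N e].
exists N.+1; rewrite addnS -addSn exprSr.
by move: e; congr ideal_gen; ring.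
Qed.

(** The witness [c] over [S] for [m + 1] gives the witness [x y c] for [m], which is
    in [Q] and therefore in [R]. *)
Lemma weakly_proregular_kplus :
  noetherian S -> val x != 0 -> val y != 0 -> weakly_proregular [:: x; y].
Proof.
move=> noethS x_neq0 y_neq0; apply: weakly_proregular2; first exact: kplus_lreg.
move=> m; have [n ltmn killed] :=
  noetherian_proregular_pair (val x) m.+1 noethS (mulfI y_neq0).
exists n; first exact: ltnW.
move=> a b /(congr1 val); rewrite !kplus_valE.
move=> /killed[c [xa yb]].
have [c' c'E] := kplus_lift (kplus_ideal_x (c * val y)).
exists c'; have nm : (n - m)%N = (n - m.+1).+1 by rewrite subnSK.
split; apply: val_inj; rewrite !kplus_valE c'E nm exprS -mulrA.
  by rewrite [_ ^+ (n - m.+1) * _]xa exprS; ring.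
by rewrite [_ ^+ (n - m.+1) * _]yb exprS; ring.
Qed.

(** If [q = u x + v y] with [u] and [v] in [S], then [q^2 = (u q) x + (v q) y],
    where [u q] and [v q] are in [R]. *)
Lemma prime_kplus_ideal (p : prime_idealr R) (q : R) :
  ideal_gen [:: x; y] `<=` [set a | a \in p] -> val q \in Q -> q \in p.
Proof.
move=> xyp Qq; have /mem_kplus_ideal[u [v e]] := Qq.
suff : q * q \in p by rewrite prime_idealrM orbb.
apply: xyp; apply/ideal_gen2E.
have [u' u'E] : exists r : R, val r = u * val q.
  by apply: kplus_lift; exact: rpredZ.
have [v' v'E] : exists r : R, val r = v * val q.
  by apply: kplus_lift; exact: rpredZ.
exists u', v'; apply: val_inj.
by rewrite !kplus_valE u'E v'E {2}e; ring.
Qed.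

Lemma cech2_null_cancel n (t r : R) :
  val t \notin Q -> cech2_null x y n (t * r) -> cech2_null x y n r.
Proof.
have /asboolP[a [q [Qq tE]]] := valP t; move=> tQ /cech2_null_kplus.
have a_neq0 : a != 0.
  by apply: contraNneq tQ => a0; rewrite tE a0 rmorph0 add0r.
have /mem_kplus_ideal[u [v qE]] := Qq.
rewrite kplus_valM tE qE => /cech2_null_unit tr; apply/cech2_null_kplus.
by apply: (tr (iota a^-1)); rewrite -rmorphM mulVf // rmorph1.
Qed.

(** Regularity applied to [y (s x) = x (s y)] gives [s x = u x] with [u] in [R]. *)
Lemma regular_kplus :
  val x != 0 -> regular_sequence [:: x; y] -> forall s, s \in kplus_pred iota Q.
Proof.
move=> x_neq0 [_ /(_ 1%N isT) /= reg] s.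
have [r rE] := kplus_lift (kplus_ideal_x s).
have [t tE] := kplus_lift (kplus_ideal_y s).
have /ideal_gen1E[u ru] : ideal_gen [:: x] r.
  apply: reg; apply/ideal_gen1E; exists t; apply: val_inj.
  by rewrite !kplus_valE rE tE; ring.
suff -> : s = val u by exact: valP.
by apply: (mulIf x_neq0); rewrite -rE ru kplus_valM.
Qed.

Hypothesis Q1 : 1 \notin Q.

(** The ideal [Q] of [R]: it is prime, [R / Q] being the field [k], and it shows
    that some prime of [R] contains [x] and [y]. *)
Definition kplus_max : {pred R} := fun r => val r \in Q.

Lemma kplus_max_idealr_closed : idealr_closed kplus_max.
Proof.
split=> [||a u v Qu Qv]; first exact: (rpred0 Q).
  exact: Q1.
have {}Qu : val u \in Q by []; have {}Qv : val v \in Q by [].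
rewrite unfold_in /kplus_max kplus_valD kplus_valM.
by apply: rpredD => //; exact: (rpredZ (val a) Qu).
Qed.

Lemma kplus_max_prime_idealr_closed : prime_idealr_closed kplus_max.
Proof.
move=> u v Quv; have {}Quv : val u * val v \in Q by [].
suff : (val u \in Q) || (val v \in Q) by [].
have /asboolP[a [q [Qq uE]]] := valP u; have [a0|a_neq0] := eqVneq a 0.
  by rewrite uE a0 rmorph0 add0r Qq.
apply/orP; right.
rewrite -[val v]mul1r -(rmorph1 iota) -(mulVf a_neq0) rmorphM -mulrA.
apply: (rpredZ (iota a^-1)); have -> : iota a * val v = val u * val v + (- val v) * q.
  by rewrite uE; ring.
by apply: rpredD => //; exact: (rpredZ (- val v)).
Qed.

Definition kplus_max_prime : prime_idealr R :=
  HB.pack kplus_max (isIdealr.Build R kplus_max kplus_max_idealr_closed)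
    (isPrimeIdealrClosed.Build R kplus_max kplus_max_prime_idealr_closed).

Lemma kplus_max_gen : ideal_gen [:: x; y] `<=` [set a | a \in kplus_max_prime].
Proof.
move=> _ /ideal_gen2E[u [v ->]] /=.
suff : val (u * x + v * y) \in Q by [].
by apply/mem_kplus_ideal; exists (val u), (val v).
Qed.

Lemma kplus_gen_proper s : ideal_gen s `<=` ideal_gen [:: x; y] -> ideal_gen s <> setT.
Proof.
move=> sxy sT; have : ideal_gen s 1 by rewrite sT.
by move=> /sxy/kplus_max_gen; exact: (negP Q1).
Qed.

Lemma strong_parameter_sequence_kplus :
    noetherian S -> val x != 0 -> val y != 0 ->
  strong_parameter_sequence [:: x; y] <->
  ~ is_zero_module (cech_cohomology_seq [:: val x; val y] 2 S^o).
Proof.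
move=> noethS x_neq0 y_neq0; split.
  move=> /(_ 2%N isT)[_ _ /(_ kplus_max_prime kplus_max_gen) nz].
  move=> /is_zero_cech2_kplus/is_zero_cech2 H0; apply: nz.
  by apply/is_zero_loc_cech2 => n a; exists 1; [exact: rpred1|exact: H0].
move=> nz [|[|[|//]]] // _.
  split.
  - apply: kplus_gen_proper; apply: ideal_gen_sub => a; rewrite inE => /eqP ->.
    by apply: ideal_gen_mem; rewrite mem_head.
  - exact/weakly_proregular1/kplus_lreg.
  - move=> p xp; apply: cech1_loc_neq0; first exact: kplus_lreg.
    by apply: xp; apply: ideal_gen_mem; rewrite mem_head.
split; [exact: kplus_gen_proper|exact: weakly_proregular_kplus|].
move=> p xyp /is_zero_loc_cech2 H0; apply: nz; apply/is_zero_cech2_kplus/is_zero_cech2.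
move=> n a; have [t pt] := H0 n a; apply: cech2_null_cancel.
by apply: contra pt; exact: prime_kplus_ideal.
Qed.

End KPlusPair.

Theorem theorem14 (k : fieldType) (S : idomainType) (iota : {rmorphism k -> S})
    (hS : essentially_of_finite_type iota) (Q : ideal S) (f g : S)
    (f_neq0 : f != 0) (g_neq0 : g != 0)
    (hQ : [set a : S | a \in Q] = ideal_gen [:: f; g])
    (hQS : [set a : S | a \in Q] <> setT) :
  let fR := kplus_of_ideal iota (ideal_gen2_mem hQ).1 in
  let gR := kplus_of_ideal iota (ideal_gen2_mem hQ).2 in
  (strong_parameter_sequence [:: fR; gR] <->
     ~ is_zero_module (cech_cohomology_seq [:: f; g] 2 S^o)) /\
  ([set a : S | a \in kplus_pred iota Q] <> setT ->
     cohen_macaulay (kplus iota Q) ->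
     is_zero_module (cech_cohomology_seq [:: f; g] 2 S^o)).
Proof.
move=> fR gR; have Q1 : 1 \notin Q.
  apply/negP => Q1; apply: hQS; apply/seteqP; split=> // a _ /=.
  by rewrite -[a]mulr1; exact: (rpredZ a Q1).
have strongP := @strong_parameter_sequence_kplus k S iota Q fR gR hQ Q1
  (noetherian_essentially_of_finite_type hS) f_neq0 g_neq0.
split=> // RS CM; apply: contrapT => /strongP/CM reg.
apply: RS; apply/seteqP; split=> // s _.
exact: (@regular_kplus k S iota Q fR gR hQ).
Qed.
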